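(* Let $\prec$ be any binary relation on terms such that, for all terms $r,s$, $r\prec s$ entails $s\not\prec r$. Any derivation in $EQ_{12}$ can be transformed into a cut-free semishortening (with respect to $\prec$) derivation in $EQ_{12}$ of its endsequent.
   Context: The language is first-order with equality and function symbols; terms contain only free object variables. $F\{v/t\}$ is the result of simultaneously replacing all occurrences of the free object variable $v$ in $F$ by the term $t$. $EQ_{12}$ is the calculus acting on sequents $\Gamma\Rightarrow H$ with $\Gamma$ a finite sequence of first-order formulae and exactly one formula $H$ in the succedent, with: logical axioms $F\Rightarrow F$; reflexivity axioms $\Rightarrow t=t$; left weakening, exchange and contraction; the cut rule (from $\Gamma\Rightarrow F$ and $\Lambda,F\Rightarrow H$ infer $\Gamma,\Lambda\Rightarrow H$); and the following equality rules, where $v$ is a free object variable occurring neither in $r$ nor in $s$: $(=_1)$: from $\Gamma\Rightarrow F\{v/r\}$ infer $\Gamma,r=s\Rightarrow F\{v/s\}$; $(=_2)$: from $\Gamma\Rightarrow F\{v/r\}$ infer $\Gamma,s=r\Rightarrow F\{v/s\}$; $(=_1^l)$: from $\Gamma,F\{v/r\}\Rightarrow H$ infer $\Gamma,F\{v/s\},r=s\Rightarrow H$; $(=_2^l)$: from $\Gamma,F\{v/r\}\Rightarrow H$ infer $\Gamma,F\{v/s\},s=r\Rightarrow H$. An application of one of these equality rules, with premiss $\Gamma\Rightarrow F\{v/r\}$ and conclusion $\Gamma,r=s\Rightarrow F\{v/s\}$ in the case of $=_1$, or $\Gamma,s=r\Rightarrow F\{v/s\}$ in the case of $=_2$, and with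 premiss $\Gamma,F\{v/r\}\Rightarrow H$ and conclusion $\Gamma,F\{v/s\},r=s\Rightarrow H$ in the case of $=_1^l$, or $\Gamma,F\{v/s\},s=r\Rightarrow H$ in the case of $=_2^l$ (replacing $r$ in the premiss by $s$ in the conclusion), is nonlengthening if $s\not\prec r$, and shortening if $r\prec s$. A derivation is nonlengthening if all its equality inferences are nonlengthening; it is semishortening if it is nonlengthening and, furthermore, all its $=_1$- and $=_1^l$-inferences are shortening. *)

(* Defs.v *)
From mathcomp Require Import all_boot.

Set Implicit Arguments.
Unset Strict Implicit.
Unset Printing Implicit Defensive.

(* Function and predicate symbols with their arities.  Equality is a logical
   symbol and is not among the predicate symbols. *)
Record signature := Signature {
  fsym : Type;
  farity : fsym -> nat;
  psym : Type;
  parity : psym -> nat }.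

(* Free and bound object variables are syntactically distinct, and both kinds
   are named by natural numbers.  A [semiterm bs] may contain the bound
   variables listed in [bs]; terms contain none. *)
Inductive semiterm (L : signature) (bs : seq nat) : Type :=
| Free of nat
| Bound (x : nat) of x \in bs
| App (f : fsym L) of {ffun 'I_(farity f) -> semiterm L bs}.

Arguments Free {L bs} _.
Arguments Bound {L bs} x _.
Arguments App {L bs} f _.

Definition term (L : signature) : Type := semiterm L [::].

(* Bound variables keep their names, so formulae that differ by a renaming of
   bound variables are different formulae. *)
Inductive semiformula (L : signature) (bs : seq nat) : Type :=
| Pred (p : psym L) of {ffun 'I_(parity p) -> semiterm L bs}
| Equal of semiterm L bs & semiterm L bs
| Bot
| Neg of semiformula L bs
| And of semiformula L bs & semiformula L bs
| Or of semiformula L bs & semiformula L bs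
| Imp of semiformula L bs & semiformula L bs
| All (x : nat) of semiformula L (x :: bs)
| Ex (x : nat) of semiformula L (x :: bs).

Arguments Pred {L bs} p _.
Arguments Equal {L bs} _ _.
Arguments Bot {L bs}.
Arguments Neg {L bs} _.
Arguments And {L bs} _ _.
Arguments Or {L bs} _ _.
Arguments Imp {L bs} _ _.
Arguments All {L bs} x _.
Arguments Ex {L bs} x _.

Definition formula (L : signature) : Type := semiformula L [::].

Fixpoint occurs (L : signature) (bs : seq nat) (v : nat)
    (t : semiterm L bs) : bool :=
  match t with
  | Free u => u == v
  | Bound _ _ => false
  | App _ ts => [exists i, occurs v (ts i)]
  end.

Fixpoint term_in (L : signature) (bs : seq nat) (t : term L) : semiterm L bs :=
  match t with
  | Free u => Free u
  | Bound _ in_nil => match notF in_nil with end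
  | App f ts => App f [ffun i => term_in bs (ts i)]
  end.

Fixpoint tsubst (L : signature) (bs : seq nat) (v : nat) (t : term L)
    (u : semiterm L bs) : semiterm L bs :=
  match u with
  | Free w => if w == v then term_in bs t else Free w
  | Bound x in_bs => Bound x in_bs
  | App f ts => App f [ffun i => tsubst v t (ts i)]
  end.

(* No capture can arise: the substituted term has no bound variables. *)
Fixpoint subst (L : signature) (bs : seq nat) (v : nat) (t : term L)
    (F : semiformula L bs) : semiformula L bs :=
  match F with
  | Pred p ts => Pred p [ffun i => tsubst v t (ts i)]
  | Equal a b => Equal (tsubst v t a) (tsubst v t b)
  | Bot => Bot
  | Neg A => Neg (subst v t A)
  | And A B => And (subst v t A) (subst v t B)
  | Or A B => Or (subst v t A) (subst v t B)
  | Imp A B => Imp (subst v t A) (subst v t B)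
  | All x A => All x (subst v t A)
  | Ex x A => Ex x (subst v t A)
  end.

(* [derivation Gam H] is the type of derivation trees in EQ_12 with endsequent
   Gam => H. *)
Inductive derivation (L : signature) : seq (formula L) -> formula L -> Type :=
| Axiom_id (F : formula L) :
    derivation [:: F] F
| Axiom_refl (t : term L) :
    derivation [::] (Equal t t)
| Weakening (Gam : seq (formula L)) (F H : formula L) :
    derivation Gam H ->
    derivation (Gam ++ [:: F]) H
| Exchange (Gam Lam : seq (formula L)) (F G H : formula L) :
    derivation (Gam ++ [:: F, G & Lam]) H ->
    derivation (Gam ++ [:: G, F & Lam]) H
| Contraction (Gam : seq (formula L)) (F H : formula L) :
    derivation (Gam ++ [:: F; F]) H ->
    derivation (Gam ++ [:: F]) H
| Cut (Gam Lam : seq (formula L)) (F H : formula L) :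
    derivation Gam F ->
    derivation (Lam ++ [:: F]) H ->
    derivation (Gam ++ Lam) H
| Eq1 (Gam : seq (formula L)) (F : formula L) (v : nat) (r s : term L) :
    ~~ occurs v r -> ~~ occurs v s ->
    derivation Gam (subst v r F) ->
    derivation (Gam ++ [:: Equal r s]) (subst v s F)
| Eq2 (Gam : seq (formula L)) (F : formula L) (v : nat) (r s : term L) :
    ~~ occurs v r -> ~~ occurs v s ->
    derivation Gam (subst v r F) ->
    derivation (Gam ++ [:: Equal s r]) (subst v s F)
| Eq1l (Gam : seq (formula L)) (F H : formula L) (v : nat) (r s : term L) :
    ~~ occurs v r -> ~~ occurs v s ->
    derivation (Gam ++ [:: subst v r F]) H ->
    derivation (Gam ++ [:: subst v s F; Equal r s]) H
| Eq2l (Gam : seq (formula L)) (F H : formula L) (v : nat) (r s : term L) :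
    ~~ occurs v r -> ~~ occurs v s ->
    derivation (Gam ++ [:: subst v r F]) H ->
    derivation (Gam ++ [:: subst v s F; Equal s r]) H.

Fixpoint cut_free (L : signature) (Gam : seq (formula L)) (H : formula L)
    (d : derivation Gam H) : bool :=
  match d with
  | Axiom_id _ | Axiom_refl _ => true
  | Weakening _ _ _ d1 => cut_free d1
  | Exchange _ _ _ _ _ d1 => cut_free d1
  | Contraction _ _ _ d1 => cut_free d1
  | Cut _ _ _ _ _ _ => false
  | Eq1 _ _ _ _ _ _ _ d1 => cut_free d1
  | Eq2 _ _ _ _ _ _ _ d1 => cut_free d1
  | Eq1l _ _ _ _ _ _ _ _ d1 => cut_free d1
  | Eq2l _ _ _ _ _ _ _ _ d1 => cut_free d1
  end.

(* [all_eq_inferences P1 P2 d]: every =_1- and =_1^l-inference of [d] satisfies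
   [P1 r s], and every =_2- and =_2^l-inference satisfies [P2 r s], where the
   inference replaces [r] in the premiss by [s] in the conclusion. *)
Fixpoint all_eq_inferences (L : signature) (P1 P2 : term L -> term L -> Prop)
    (Gam : seq (formula L)) (H : formula L) (d : derivation Gam H) : Prop :=
  match d with
  | Axiom_id _ | Axiom_refl _ => True
  | Weakening _ _ _ d1 => all_eq_inferences P1 P2 d1
  | Exchange _ _ _ _ _ d1 => all_eq_inferences P1 P2 d1
  | Contraction _ _ _ d1 => all_eq_inferences P1 P2 d1
  | Cut _ _ _ _ d1 d2 => all_eq_inferences P1 P2 d1 /\ all_eq_inferences P1 P2 d2
  | Eq1 _ _ _ r s _ _ d1 => P1 r s /\ all_eq_inferences P1 P2 d1
  | Eq2 _ _ _ r s _ _ d1 => P2 r s /\ all_eq_inferences P1 P2 d1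
  | Eq1l _ _ _ _ r s _ _ d1 => P1 r s /\ all_eq_inferences P1 P2 d1
  | Eq2l _ _ _ _ r s _ _ d1 => P2 r s /\ all_eq_inferences P1 P2 d1
  end.

Definition nonlengthening_inference (L : signature)
    (prec : term L -> term L -> Prop) (r s : term L) : Prop := ~ prec s r.

Definition shortening_inference (L : signature)
    (prec : term L -> term L -> Prop) (r s : term L) : Prop := prec r s.

Definition nonlengthening (L : signature) (prec : term L -> term L -> Prop)
    (Gam : seq (formula L)) (H : formula L) (d : derivation Gam H) : Prop :=
  all_eq_inferences (nonlengthening_inference prec)
    (nonlengthening_inference prec) d.

Definition semishortening (L : signature) (prec : term L -> term L -> Prop)
    (Gam : seq (formula L)) (H : formula L) (d : derivation Gam H) : Prop :=
  nonlengthening prec d /\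
  all_eq_inferences (shortening_inference prec) (fun _ _ => True) d.

(* Main.v *)
From Stdlib Require Import List Permutation Classical_Prop Relations_3 Relations_3_facts.
From mathcomp Require Import all_boot.
Require Import Defs.

Set Implicit Arguments.
Unset Strict Implicit.
Unset Printing Implicit Defensive.

(** Read bottom-up, an equality inference rewrites a formula of the sequent,
in the antecedent or in the succedent, by an equation of the antecedent.
Semishortening leaves each equation a = b exactly one direction: b -> a by =_1
when a prec b, and a -> b by =_2 otherwise.  The theorem thus says that
rewriting in these imposed directions proves everything that equational
reasoning with cuts proves.

The directions need not terminate, since prec is arbitrary, but they become
confluent once the antecedent is saturated, that is, closed under rewriting by
its own equations; left inferences perform precisely this closure.  The only
critical peaks of ground rewriting arise when the left-hand side l of a rule
l -> r is itself rewritten to some t.  The saturated antecedent then contains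
the equation between t and r, in one order or the other, and that equation,
oriented either way, joins t and r in a single step.  Hence rewriting in at
most one step has the diamond property ([freduces_confluent]), and the strip
argument gives confluence without termination.

By confluence, joinability is transitive, so it is a congruence containing the
equations of the antecedent.  Call Gam => H entailed when H is joinable either
with a member of Gam or with some t = t.  This notion is closed under all the
rules of the calculus, cut included ([entailed_cut], [derivation_entailed]).
Conversely, a common reduct of F in Gam and of H is added to the antecedent by
saturation and reached from H by right inferences, which yields a cut-free
semishortening derivation ([entailed_semishort]). *)

(** * Joinability in abstract rewriting *)

Lemma Rstar_map (T U : Type) (R : T -> T -> Prop) (S : U -> U -> Prop)
    (f : T -> U) (f_mono : forall x y, R x y -> S (f x) (f y)) (x y : T) :
  Rstar T R x y -> Rstar U S (f x) (f y).
Proof.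
elim=> [z | a b c Rab _ IH]; first exact: Rstar_0.
exact: Rstar_n (f_mono _ _ Rab) IH.
Qed.

Lemma coherent_map (T U : Type) (R : T -> T -> Prop) (S : U -> U -> Prop)
    (f : T -> U) (f_mono : forall x y, R x y -> S (f x) (f y)) (x y : T) :
  coherent T R x y -> coherent U S (f x) (f y).
Proof.
by case=> z [xz yz]; exists (f z); split; apply: (Rstar_map f_mono).
Qed.

Lemma coherent_refl (T : Type) (R : T -> T -> Prop) (x : T) : coherent T R x x.
Proof. by exists x; split; apply: Rstar_0. Qed.

Lemma coherent_step (T : Type) (R : T -> T -> Prop) (x y : T) :
  R x y -> coherent T R x y.
Proof. by move=> Rxy; apply/Rstar_imp_coherent/Rstar_contains_R. Qed.

(** Confluence is what makes joinability an equivalence relation; here it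
comes from the diamond property, which survives the lack of termination. *)
Lemma coherent_trans (T : Type) (R : T -> T -> Prop) :
  Strongly_confluent T R -> Relations_1.Transitive T (coherent T R).
Proof.
move=> /Strong_confluence confR x y z [u [xu yu]] [v [yv zv]].
have [w [uw vw]] := confR _ _ _ yu yv.
by exists w; split; [apply: Rstar_transitive xu uw | apply: Rstar_transitive zv vw].
Qed.

(** An invariant in both directions crosses the common reduct. *)
Lemma coherent_invariant (T : Type) (R : T -> T -> Prop) (P : T -> Prop)
    (P_inv : forall x y, R x y -> (P x <-> P y)) (x y : T) :
  coherent T R x y -> P x -> P y.
Proof.
have star a b : Rstar T R a b -> (P a <-> P b).
  by elim=> [// | c e g /P_inv ? _ ?]; tauto.
by case=> z [/star ? /star ?]; tauto.
Qed.

(** * Rewriting one argument *)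

Definition update (n : nat) (T : Type) (ts : {ffun 'I_n -> T}) (i : 'I_n)
    (u : T) : {ffun 'I_n -> T} :=
  [ffun j => if j == i then u else ts j].

Definition one_arg (n : nat) (T : Type) (R : T -> T -> Prop)
    (ts us : {ffun 'I_n -> T}) : Prop :=
  exists i u, R (ts i) u /\ us = update ts i u.

Lemma update_eq (n : nat) (T : Type) (ts : {ffun 'I_n -> T}) i u :
  update ts i u i = u.
Proof. by rewrite ffunE eqxx. Qed.

Lemma update_neq (n : nat) (T : Type) (ts : {ffun 'I_n -> T}) i j u :
  j != i -> update ts i u j = ts j.
Proof. by rewrite ffunE => /negbTE ->. Qed.

Lemma update_update (n : nat) (T : Type) (ts : {ffun 'I_n -> T}) i u w :
  update (update ts i u) i w = update ts i w.
Proof. by apply/ffunP => j; rewrite !ffunE; case: eqP. Qed.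

Lemma updateC (n : nat) (T : Type) (ts : {ffun 'I_n -> T}) i j u w :
  i != j -> update (update ts i u) j w = update (update ts j w) i u.
Proof.
move=> neq_ij; apply/ffunP => k; rewrite !ffunE.
by case: eqP => // ->; rewrite eq_sym (negbTE neq_ij).
Qed.

(** Steps in distinct arguments commute, so only two steps in the same
argument need a hypothesis. *)
Lemma one_arg_diamond (n : nat) (T : Type) (R1 R2 C : T -> T -> Prop)
    (ts us vs : {ffun 'I_n -> T}) :
  (forall x y, R1 x y -> C x y) -> (forall x y, R2 x y -> C x y) ->
  (forall i x y, R1 (ts i) x -> R2 (ts i) y -> exists z, C x z /\ C y z) ->
  one_arg R1 ts us -> one_arg R2 ts vs ->
  exists ws, one_arg C us ws /\ one_arg C vs ws.
Proof.
move=> R1C R2C dia [i [x [R1x ->]]] [j [y [R2y ->]]].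
have [eq_ij | neq_ij] := eqVneq i j.
  move: y R2y; rewrite -{j}eq_ij => y R2y; have [z [Cxz Cyz]] := dia _ _ _ R1x R2y.
  by exists (update ts i z); split; exists i, z; rewrite update_eq update_update.
exists (update (update ts i x) j y); split.
  by exists j, y; rewrite update_neq 1?eq_sym //; split=> //; apply: R2C.
by exists i, x; rewrite update_neq // updateC //; split=> //; apply: R1C.
Qed.

(** Congruence in all arguments at once follows from congruence in one,
by changing the arguments one after the other. *)
Lemma one_arg_chain (n : nat) (T : Type) (R : T -> T -> Prop)
    (Q : {ffun 'I_n -> T} -> {ffun 'I_n -> T} -> Prop) :
  (forall ts, Q ts ts) -> (forall ts us vs, Q ts us -> Q us vs -> Q ts vs) ->
  (forall ts us, one_arg R ts us -> Q ts us) ->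
  forall ts us : {ffun 'I_n -> T}, (forall i, R (ts i) (us i)) -> Q ts us.
Proof.
move=> Qrefl Qtrans Qone ts us Rtu.
pose mix (s : seq 'I_n) := [ffun i => if i \in s then us i else ts i] : {ffun 'I_n -> T}.
have Qmix s : uniq s -> Q ts (mix s).
  elim: s => [_ | i s IH /= /andP[nsi /IH Qs]].
    by have -> : mix [::] = ts by apply/ffunP => i; rewrite ffunE.
  apply: Qtrans Qs (Qone _ _ _); exists i, (us i); split.
    by rewrite ffunE (negbTE nsi).
  by apply/ffunP => j; rewrite !ffunE inE; case: eqP => // ->.
have <- : mix (enum 'I_n) = us by apply/ffunP => i; rewrite ffunE mem_enum.
exact: Qmix (enum_uniq _).
Qed.

Definition one_side (X Y Z : Type) (op : X -> Y -> Z) (R : X -> X -> Prop)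
    (S : Y -> Y -> Prop) (a : X) (b : Y) (c : Z) : Prop :=
  (exists a', R a a' /\ c = op a' b) \/ (exists b', S b b' /\ c = op a b').

(** The counterpart of the diamond for binary operations. *)
Lemma one_side_diamond (X Y Z : Type) (op : X -> Y -> Z)
    (R1 R2 RC : X -> X -> Prop) (S1 S2 SC : Y -> Y -> Prop) (C : Z -> Z -> Prop)
    (a : X) (b : Y) (c d : Z) :
  (forall x y, R1 x y -> RC x y) -> (forall x y, R2 x y -> RC x y) ->
  (forall x y, S1 x y -> SC x y) -> (forall x y, S2 x y -> SC x y) ->
  (forall x x' y, RC x x' -> C (op x y) (op x' y)) ->
  (forall x y y', SC y y' -> C (op x y) (op x y')) ->
  (forall x y, R1 a x -> R2 a y -> exists z, RC x z /\ RC y z) ->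
  (forall x y, S1 b x -> S2 b y -> exists z, SC x z /\ SC y z) ->
  one_side op R1 S1 a b c -> one_side op R2 S2 a b d ->
  exists e, C c e /\ C d e.
Proof.
move=> R1C R2C S1C S2C opl opr diaR diaS.
case=> [[x [ax ->]] | [x [bx ->]]] [[y [ay ->]] | [y [bY ->]]].
- by have [z [? ?]] := diaR _ _ ax ay; exists (op z b); split; apply: opl.
- by exists (op x y); split; [apply/opr/S2C | apply/opl/R1C].
- by exists (op y x); split; [apply/opl/R2C | apply/opr/S1C].
- by have [z [? ?]] := diaS _ _ bx bY; exists (op a z); split; apply: opr.
Qed.

(** * Rewriting terms and formulae *)

Section Rewriting.
Context {L : signature}.
Implicit Types (l r s t : term L).

Lemma semiterm_induction (bs : seq nat) (P : semiterm L bs -> Prop) :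
  (forall v, P (Free v)) -> (forall x in_bs, P (Bound x in_bs)) ->
  (forall (f : fsym L) (ts : {ffun 'I_(farity f) -> semiterm L bs}),
    (forall i, P (ts i)) -> P (App f ts)) ->
  forall u, P u.
Proof.
move=> PFree PBound PApp; fix IH 1 => -[v | x in_bs | f ts].
- exact: PFree.
- exact: PBound.
- by apply: PApp => i; apply: IH.
Qed.

(** A single occurrence is replaced, although an equality inference may replace
many at once: single occurrences keep the analysis of peaks elementary.  The
recursion on the rewritten term, rather than an inductive family, spares the
inversion of equations between applications of a symbol whose arity depends on
it. *)
Fixpoint rewrites l r (bs : seq nat) (t u : semiterm L bs) : Prop :=
  (t = term_in bs l /\ u = term_in bs r) \/
  match t with
  | App f ts => exists us : {ffun _ -> _},
      one_arg (fun x y => rewrites l r x y) ts us /\ u = App f us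
  | _ => False
  end.

Fixpoint frewrites l r (bs : seq nat) (F G : semiformula L bs) : Prop :=
  match F with
  | Pred p ts => exists us : {ffun _ -> _},
      one_arg (@rewrites l r bs) ts us /\ G = Pred p us
  | Equal a b => one_side Equal (@rewrites l r bs) (@rewrites l r bs) a b G
  | Bot => False
  | Neg A => exists A', frewrites l r A A' /\ G = Neg A'
  | And A B =>
      one_side And (fun C D => frewrites l r C D) (fun C D => frewrites l r C D) A B G
  | Or A B =>
      one_side Or (fun C D => frewrites l r C D) (fun C D => frewrites l r C D) A B G
  | Imp A B =>
      one_side Imp (fun C D => frewrites l r C D) (fun C D => frewrites l r C D) A B G
  | All x A => exists A', frewrites l r A A' /\ G = All x A'
  | Ex x A => exists A', frewrites l r A A' /\ G = Ex x A'
  end.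

Lemma rewrites_root l r bs : rewrites l r (term_in bs l) (term_in bs r).
Proof. by case: l => //= *; left. Qed.

(** Serves for the injectivity of [term_in]; the value on bound variables is
arbitrary. *)
Fixpoint closed_part (bs : seq nat) (t : semiterm L bs) : term L :=
  match t with
  | Free v => Free v
  | Bound _ _ => Free 0
  | App f ts => App f [ffun i => closed_part (ts i)]
  end.

Lemma term_inK bs : cancel (@term_in L bs) (@closed_part bs).
Proof.
elim/semiterm_induction => //= f ts IH.
by congr App; apply/ffunP => i; rewrite !ffunE.
Qed.

Lemma term_in_nil t : term_in [::] t = t.
Proof.
elim/semiterm_induction: t => //= f ts IH.
by congr App; apply/ffunP => i; rewrite !ffunE.
Qed.

(** A term without bound variables only rewrites to such terms, so a peak below
a root step, under any quantifiers, comes from a rewriting of the left-hand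
side itself. *)
Lemma rewrites_term_in l r bs t (u : semiterm L bs) :
  rewrites l r (term_in bs t) u ->
  exists2 t', u = term_in bs t' & rewrites l r t t'.
Proof.
have root s : term_in bs s = term_in bs l -> rewrites l r s r.
  move=> /(can_inj (@term_inK bs)) ->.
  by have := rewrites_root l r [::]; rewrite !term_in_nil.
elim/semiterm_induction: t u => [v | // | f ts IH] u.
  by case=> // -[eq_l ->]; exists r => //; apply: root.
case=> [[eq_l ->] | [us [[i [u' [+ ->]]] ->]]].
  by exists r => //; apply: root.
rewrite ffunE => /IH[t' -> tt']; exists (App f (update ts i t')) => /=.
  by congr App; apply/ffunP => j; rewrite !ffunE; case: eqP.
by right; exists (update ts i t'); split=> //; exists i, t'.
Qed.

Lemma term_in_rewrites l r bs t u :
  rewrites l r t u -> rewrites l r (term_in bs t) (term_in bs u).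
Proof.
elim/semiterm_induction: t u => [v | // | f ts IH] u.
  by case=> [[] | //]; rewrite !term_in_nil => -> ->; apply: rewrites_root.
case=> [[eq_l ->] | [us [[i [u' [tu' ->]]] ->]]].
  by rewrite eq_l !term_in_nil; apply: rewrites_root.
right; eexists; split; last by [].
exists i, (term_in bs u'); split; first by rewrite ffunE; apply: IH.
by apply/ffunP => j; rewrite !ffunE; case: eqP.
Qed.

(** * Confluence of interreduced systems *)

Section System.
Context (rule : term L -> term L -> Prop).

(** At most one step: with reflexivity built in, the local peaks close with one
step on each side. *)
Definition reduces (bs : seq nat) (t u : semiterm L bs) : Prop :=
  t = u \/ exists l r, rule l r /\ rewrites l r t u.

Definition freduces (bs : seq nat) (F G : semiformula L bs) : Prop :=
  F = G \/ exists l r, rule l r /\ frewrites l r F G.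

Lemma reduces_App bs (f : fsym L) (ts us : {ffun 'I_(farity f) -> semiterm L bs}) :
  one_arg (@reduces bs) ts us -> reduces (App f ts) (App f us).
Proof.
case=> i [u [[<- | [l [r [lr tu]]]] ->]].
  by left; congr App; apply/ffunP => j; rewrite ffunE; case: eqP => // ->.
by right; exists l, r; split=> //; right; exists (update ts i u); split=> //; exists i, u.
Qed.

Lemma freduces_Pred bs (p : psym L) (ts us : {ffun 'I_(parity p) -> semiterm L bs}) :
  one_arg (@reduces bs) ts us -> freduces (Pred p ts) (Pred p us).
Proof.
case=> i [u [[<- | [l [r [lr tu]]]] ->]].
  by left; congr Pred; apply/ffunP => j; rewrite ffunE; case: eqP => // ->.
by right; exists l, r; split=> //; exists (update ts i u); split=> //; exists i, u.
Qed.

Ltac one_step :=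
  case=> [-> | [? [? [? ?]]]]; first (by left);
  right; do 2 eexists; split; [eassumption | rewrite /= /one_side; eauto].

Lemma freduces_Equal_l bs (a a' b : semiterm L bs) :
  reduces a a' -> freduces (Equal a b) (Equal a' b).
Proof. one_step. Qed.
Lemma freduces_Equal_r bs (a b b' : semiterm L bs) :
  reduces b b' -> freduces (Equal a b) (Equal a b').
Proof. one_step. Qed.
Lemma freduces_Neg bs (A A' : semiformula L bs) :
  freduces A A' -> freduces (Neg A) (Neg A').
Proof. one_step. Qed.
Lemma freduces_And_l bs (A A' B : semiformula L bs) :
  freduces A A' -> freduces (And A B) (And A' B).
Proof. one_step. Qed.
Lemma freduces_And_r bs (A B B' : semiformula L bs) :
  freduces B B' -> freduces (And A B) (And A B').
Proof. one_step. Qed.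
Lemma freduces_Or_l bs (A A' B : semiformula L bs) :
  freduces A A' -> freduces (Or A B) (Or A' B).
Proof. one_step. Qed.
Lemma freduces_Or_r bs (A B B' : semiformula L bs) :
  freduces B B' -> freduces (Or A B) (Or A B').
Proof. one_step. Qed.
Lemma freduces_Imp_l bs (A A' B : semiformula L bs) :
  freduces A A' -> freduces (Imp A B) (Imp A' B).
Proof. one_step. Qed.
Lemma freduces_Imp_r bs (A B B' : semiformula L bs) :
  freduces B B' -> freduces (Imp A B) (Imp A B').
Proof. one_step. Qed.
Lemma freduces_All bs x (A A' : semiformula L (x :: bs)) :
  freduces A A' -> freduces (All x A) (All x A').
Proof. one_step. Qed.
Lemma freduces_Ex bs x (A A' : semiformula L (x :: bs)) :
  freduces A A' -> freduces (Ex x A) (Ex x A').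
Proof. one_step. Qed.

(** The closure property of the oriented equations of a saturated antecedent.
The direction of the new rule is left open, as nothing relates it to the
directions of the two given ones. *)
Definition interreduced : Prop :=
  forall l r l' r' t, rule l r -> rule l' r' -> rewrites l' r' l t ->
  rule t r \/ rule r t.

Lemma reduces_rule bs t u : rule t u \/ rule u t ->
  exists w, reduces (term_in bs t) w /\ reduces (term_in bs u) w.
Proof.
by case=> lr; [exists (term_in bs u) | exists (term_in bs t)]; split; try (by left);
  right; do 2![eexists]; split; eauto; apply: rewrites_root.
Qed.

(** The only critical peak.  Both reducts are the two sides of a rule. *)
Lemma root_peak bs l r l' r' (t : semiterm L bs) :
  interreduced -> rule l r -> rule l' r' -> rewrites l' r' (term_in bs l) t ->
  exists w, reduces (term_in bs r) w /\ reduces t w.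
Proof.
move=> inter lr lr' /rewrites_term_in[t' -> lt'].
have [w [tw rw]] := reduces_rule bs (inter _ _ _ _ _ lr lr' lt').
by exists w.
Qed.

Lemma reduces_step bs l r (t u : semiterm L bs) :
  rule l r -> rewrites l r t u -> reduces t u.
Proof. by move=> lr tu; right; exists l, r. Qed.

Lemma rewrites_peak bs l r l' r' (u s t : semiterm L bs) :
  interreduced -> rule l r -> rule l' r' -> rewrites l r u s ->
  rewrites l' r' u t -> exists w, reduces s w /\ reduces t w.
Proof.
move=> inter lr lr'.
have root v x y : v = term_in bs l /\ x = term_in bs r -> rewrites l' r' v y ->
    exists w, reduces x w /\ reduces y w.
  by case=> -> ->; apply: root_peak.
have root' v x y : v = term_in bs l' /\ y = term_in bs r' -> rewrites l r v x ->
    exists w, reduces x w /\ reduces y w.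
  by case=> -> -> /(root_peak inter lr' lr)[w [? ?]]; exists w.
elim/semiterm_induction: u s t => [v | x in_bs | f ts IH] s t us ut.
- by case: us => // us; apply: root us ut.
- by case: us => // us; apply: root us ut.
case: (us) => [? | [ss [one_s eq_s]]]; first exact: root ut.
case: (ut) => [? | [vs [one_t eq_t]]]; first exact: root' us.
have [|||ws [sw tw]] := one_arg_diamond (C := @reduces bs) _ _ _ one_s one_t.
- by move=> *; apply: reduces_step lr _.
- by move=> *; apply: reduces_step lr' _.
- exact: IH.
by exists (App f ws); rewrite eq_s eq_t; split; apply: reduces_App.
Qed.

Lemma reduces_confluent bs : interreduced -> Strongly_confluent _ (@reduces bs).
Proof.
move=> inter u s t [<- | [l [r [lr us]]]] [<- | [l' [r' [lr' ut]]]].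
- by exists u; split; left.
- by exists t; split; [apply: reduces_step ut | left].
- by exists s; split; [left | apply: reduces_step us].
exact: rewrites_peak inter lr lr' us ut.
Qed.

Lemma freduces_step bs l r (F G : semiformula L bs) :
  rule l r -> frewrites l r F G -> freduces F G.
Proof. by move=> lr FG; right; exists l, r. Qed.

Lemma frewrites_peak bs l r l' r' (F G H : semiformula L bs) :
  interreduced -> rule l r -> rule l' r' -> frewrites l r F G ->
  frewrites l' r' F H -> exists K, freduces G K /\ freduces H K.
Proof.
move=> inter lr lr'.
have tpeak bs' x y z := @rewrites_peak bs' _ _ _ _ x y z inter lr lr'.
have t1 bs' x y := @reduces_step bs' _ _ x y lr.
have t2 bs' x y := @reduces_step bs' _ _ x y lr'.
have f1 bs' x y := @freduces_step bs' _ _ x y lr.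
have f2 bs' x y := @freduces_step bs' _ _ x y lr'.
elim: F G H => {bs} [bs p ts | bs a b | // | bs A IH | bs A IHA B IHB
  | bs A IHA B IHB | bs A IHA B IHB | bs x A IH | bs x A IH] G H /=.
- case=> us [one_u ->] [vs [one_v ->]].
  have [|||ws [uw vw]] := one_arg_diamond (C := @reduces bs) _ _ _ one_u one_v.
  + exact: t1.
  + exact: t2.
  + by move=> i x y; apply: tpeak.
  by exists (Pred p ws); split; apply: freduces_Pred.
- by apply: one_side_diamond (@freduces_Equal_l bs) (@freduces_Equal_r bs) _ _; eauto.
- case=> [C [AC ->]] [D [AD ->]]; have [E [? ?]] := IH _ _ AC AD.
  by exists (Neg E); split; apply: freduces_Neg.
- by apply: one_side_diamond (@freduces_And_l bs) (@freduces_And_r bs) _ _; eauto.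
- by apply: one_side_diamond (@freduces_Or_l bs) (@freduces_Or_r bs) _ _; eauto.
- by apply: one_side_diamond (@freduces_Imp_l bs) (@freduces_Imp_r bs) _ _; eauto.
- case=> [C [AC ->]] [D [AD ->]]; have [E [? ?]] := IH _ _ AC AD.
  by exists (All x E); split; apply: freduces_All.
- case=> [C [AC ->]] [D [AD ->]]; have [E [? ?]] := IH _ _ AC AD.
  by exists (Ex x E); split; apply: freduces_Ex.
Qed.

Lemma freduces_confluent bs : interreduced -> Strongly_confluent _ (@freduces bs).
Proof.
move=> inter F G H [<- | [l [r [lr FG]]]] [<- | [l' [r' [lr' FH]]]].
- by exists F; split; left.
- by exists H; split; [apply: freduces_step FH | left].
- by exists G; split; [left | apply: freduces_step FG].
exact: frewrites_peak inter lr lr' FG FH.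
Qed.

Definition tjoin (bs : seq nat) : semiterm L bs -> semiterm L bs -> Prop :=
  coherent _ (@reduces bs).
Definition fjoin (bs : seq nat) : semiformula L bs -> semiformula L bs -> Prop :=
  coherent _ (@freduces bs).

Lemma term_in_join bs s t : tjoin s t -> tjoin (term_in bs s) (term_in bs t).
Proof.
move=> st; apply: (coherent_map (S := @reduces bs) (f := @term_in L bs) _ st).
move=> x y [-> | [l [r [lr xy]]]]; first by left.
by apply: reduces_step lr _; apply: term_in_rewrites.
Qed.

Lemma App_join bs (f : fsym L) (ts us : {ffun 'I_(farity f) -> semiterm L bs}) :
  interreduced ->
  (forall i, tjoin (ts i) (us i)) -> tjoin (App f ts) (App f us).
Proof.
move=> inter; apply: (one_arg_chain (R := @tjoin bs)
  (Q := fun ts us => tjoin (App f ts) (App f us)))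
  => [? | ? ? ? | ws vs [i [u [wu ->]]]].
- exact: coherent_refl.
- exact: coherent_trans (reduces_confluent inter) _ _ _.
have /(_ _)/= :=
  coherent_map (S := @reduces bs) (f := fun x => App f (update ws i x)) _ wu.
rewrite [update ws i (ws i)](_ : _ = ws); last first.
  by apply/ffunP => j; rewrite ffunE; case: eqP => // ->.
apply=> x y xy; apply: reduces_App; exists i, y.
by rewrite update_eq update_update.
Qed.

Lemma Pred_join bs (p : psym L) (ts us : {ffun 'I_(parity p) -> semiterm L bs}) :
  interreduced ->
  (forall i, tjoin (ts i) (us i)) -> fjoin (Pred p ts) (Pred p us).
Proof.
move=> inter; apply: (one_arg_chain (R := @tjoin bs)
  (Q := fun ts us => fjoin (Pred p ts) (Pred p us)))
  => [? | ? ? ? | ws vs [i [u [wu ->]]]].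
- exact: coherent_refl.
- exact: coherent_trans (freduces_confluent inter) _ _ _.
have /(_ _)/= :=
  coherent_map (S := @freduces bs) (f := fun x => Pred p (update ws i x)) _ wu.
rewrite [update ws i (ws i)](_ : _ = ws); last first.
  by apply/ffunP => j; rewrite ffunE; case: eqP => // ->.
apply=> x y xy; apply: freduces_Pred; exists i, y.
by rewrite update_eq update_update.
Qed.

Lemma tsubst_join bs v s t (u : semiterm L bs) : interreduced ->
  tjoin s t -> tjoin (tsubst v s u) (tsubst v t u).
Proof.
move=> inter join_st.
elim/semiterm_induction: u => [w | x in_bs | f ts IH] /=.
- by case: eqP => _; [apply: term_in_join | apply: coherent_refl].
- exact: coherent_refl.
by apply: App_join => // i; rewrite !ffunE.
Qed.

Lemma subst_join bs v s t (F : semiformula L bs) : interreduced ->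
  tjoin s t -> fjoin (subst v s F) (subst v t F).
Proof.
move=> inter join_st.
have tr bs' := coherent_trans (@freduces_confluent bs' inter).
have ts bs' u := @tsubst_join bs' v s t u inter join_st.
elim: F => {bs} [bs p us | bs a b | bs | bs A IH | bs A IHA B IHB
  | bs A IHA B IHB | bs A IHA B IHB | bs x A IH | bs x A IH] /=.
- by apply: Pred_join => // i; rewrite !ffunE; apply: ts.
- apply: (tr _ _ (Equal (tsubst v t a) (tsubst v s b))).
    by apply: (coherent_map (S := @freduces _) (f := Equal^~ _) _ (ts _ _))
      => ? ?; apply: freduces_Equal_l.
  by apply: (coherent_map (S := @freduces _) (f := Equal _) _ (ts _ _))
    => ? ?; apply: freduces_Equal_r.
- exact: coherent_refl.
- by apply: (coherent_map (S := @freduces _) (f := Neg) _ IH)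
  => ? ?; apply: freduces_Neg.
- apply: (tr _ _ (And (subst v t A) (subst v s B))).
    by apply: (coherent_map (S := @freduces _) (f := And^~ _) _ IHA)
      => ? ?; apply: freduces_And_l.
  by apply: (coherent_map (S := @freduces _) (f := And _) _ IHB)
    => ? ?; apply: freduces_And_r.
- apply: (tr _ _ (Or (subst v t A) (subst v s B))).
    by apply: (coherent_map (S := @freduces _) (f := Or^~ _) _ IHA)
      => ? ?; apply: freduces_Or_l.
  by apply: (coherent_map (S := @freduces _) (f := Or _) _ IHB)
    => ? ?; apply: freduces_Or_r.
- apply: (tr _ _ (Imp (subst v t A) (subst v s B))).
    by apply: (coherent_map (S := @freduces _) (f := Imp^~ _) _ IHA)
      => ? ?; apply: freduces_Imp_l.
  by apply: (coherent_map (S := @freduces _) (f := Imp _) _ IHB)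
    => ? ?; apply: freduces_Imp_r.
- by apply: (coherent_map (S := @freduces _) (f := All x) _ IH)
  => ? ?; apply: freduces_All.
- by apply: (coherent_map (S := @freduces _) (f := Ex x) _ IH)
  => ? ?; apply: freduces_Ex.
Qed.

(** Being an equation with sides joinable to a and b is preserved by rewriting
in both directions, hence along a joinability. *)
Lemma fjoin_Equal bs (a b : semiterm L bs) (F : semiformula L bs) :
  interreduced -> fjoin (Equal a b) F ->
  exists a' b', [/\ F = Equal a' b', tjoin a a' & tjoin b b'].
Proof.
move=> inter; have tr := coherent_trans (@reduces_confluent bs inter).
pose P (G : semiformula L bs) :=
  exists a' b', [/\ G = Equal a' b', tjoin a a' & tjoin b b'].
move=> /(@coherent_invariant _ _ P); apply; last first.
  by exists a, b; split=> //; apply: coherent_refl.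
move=> G H [-> // | [l [r [lr GH]]]]; split.
  case=> a' [b' [eq_G aa' bb']]; move: GH; rewrite eq_G.
  case=> [[c [ac ->]] | [c [bc ->]]].
    by exists c, b'; split=> //; apply: tr aa' (coherent_step (reduces_step lr ac)).
  by exists a', c; split=> //; apply: tr bb' (coherent_step (reduces_step lr bc)).
case=> a' [b' [eq_H aa' bb']]; move: GH; rewrite eq_H.
have back x y : rewrites l r x y -> tjoin y x.
  by move=> xy; apply/coherent_symmetric/coherent_step/(reduces_step lr).
case: G => //= [p ts [us [_ //]] | c d | A [? [] //] | A B [] [? [] //]
  | A B [] [? [] //] | A B [] [? [] //] | x A [? [] //] | x A [? [] //]].
case=> [[e [/back ec [? ?]]] | [e [/back ed [? ?]]]]; subst.
  by exists c, d; split=> //; apply: tr aa' ec.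
by exists c, d; split=> //; apply: tr bb' ed.
Qed.
End System.

(** * Rewriting steps as substitution instances *)

Fixpoint var_bound (bs : seq nat) (t : semiterm L bs) : nat :=
  match t with
  | Free v => v.+1
  | Bound _ _ => 0
  | App _ ts => \max_i var_bound (ts i)
  end.

Fixpoint fvar_bound (bs : seq nat) (F : semiformula L bs) : nat :=
  match F with
  | Pred _ ts => \max_i var_bound (ts i)
  | Equal a b => maxn (var_bound a) (var_bound b)
  | Bot => 0
  | Neg A => fvar_bound A
  | And A B | Or A B | Imp A B => maxn (fvar_bound A) (fvar_bound B)
  | All _ A | Ex _ A => fvar_bound A
  end.

Lemma occurs_bound bs v (t : semiterm L bs) : var_bound t <= v -> ~~ occurs v t.
Proof.
elim/semiterm_induction: t => //= [w | f ts IH].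
  by move=> lt_wv; rewrite neq_ltn lt_wv.
move=> /bigmax_leqP le_v; apply/existsPn => i; exact/IH/le_v.
Qed.

Lemma tsubst_fresh bs v s (t : semiterm L bs) : var_bound t <= v -> tsubst v s t = t.
Proof.
elim/semiterm_induction: t => //= [w | f ts IH].
  by move=> lt_wv; rewrite ltn_eqF.
move=> /bigmax_leqP le_v; congr App; apply/ffunP => i; rewrite ffunE; exact/IH/le_v.
Qed.

Lemma subst_fresh bs v s (F : semiformula L bs) : fvar_bound F <= v -> subst v s F = F.
Proof.
elim: F => //= {bs} [bs p ts | bs a b | bs A IH | bs A IHA B IHB
  | bs A IHA B IHB | bs A IHA B IHB | bs x A IH | bs x A IH].
- move=> /bigmax_leqP le_v; congr Pred; apply/ffunP => i.
  by rewrite ffunE tsubst_fresh ?le_v.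
- by rewrite geq_max => /andP[? ?]; rewrite !tsubst_fresh.
- by move/IH->.
- by rewrite geq_max => /andP[/IHA-> /IHB->].
- by rewrite geq_max => /andP[/IHA-> /IHB->].
- by rewrite geq_max => /andP[/IHA-> /IHB->].
- by move/IH->.
- by move/IH->.
Qed.

Lemma one_arg_context n bs l r v (ts us : {ffun 'I_n -> semiterm L bs}) :
  (forall i, var_bound (ts i) <= v) ->
  (forall i u, rewrites l r (ts i) u ->
     exists c, ts i = tsubst v l c /\ u = tsubst v r c) ->
  one_arg (@rewrites l r bs) ts us ->
  exists cs : {ffun 'I_n -> semiterm L bs},
    ts = [ffun i => tsubst v l (cs i)] /\ us = [ffun i => tsubst v r (cs i)].
Proof.
move=> le_v ctx [i [u [/ctx[c [tc ->]] ->]]]; exists (update ts i c).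
split; apply/ffunP => j; rewrite !ffunE; case: eqP => [e | _] //.
- by rewrite e.
- by rewrite tsubst_fresh.
- by rewrite tsubst_fresh.
Qed.

Lemma rewrites_context bs l r v (t u : semiterm L bs) :
  var_bound t <= v -> rewrites l r t u ->
  exists c, t = tsubst v l c /\ u = tsubst v r c.
Proof.
have root x y : x = term_in bs l /\ y = term_in bs r ->
    exists c, x = tsubst v l c /\ y = tsubst v r c.
  by move=> eqs; exists (Free v); rewrite /= eqxx.
elim/semiterm_induction: t u => [w | x in_bs | f ts IH] u /=.
- by move=> _ [/root|].
- by move=> _ [/root|].
move=> /bigmax_leqP le_v [/root // | [us [one_u ->]]].
have [||cs [-> ->]] := one_arg_context (v := v) _ _ one_u.
- by move=> i; apply: le_v.
- by move=> i w; apply: IH; apply: le_v.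
by exists (App f cs).
Qed.

Lemma frewrites_context bs l r v (F G : semiformula L bs) :
  fvar_bound F <= v -> frewrites l r F G ->
  exists C, F = subst v l C /\ G = subst v r C.
Proof.
elim: F G => {bs} [bs p ts | bs a b | // | bs A IH | bs A IHA B IHB
  | bs A IHA B IHB | bs A IHA B IHB | bs x A IH | bs x A IH] G /=.
- move=> /bigmax_leqP le_v [us [one_u ->]].
  have [||cs [-> ->]] := one_arg_context (v := v) _ _ one_u.
  + by move=> i; apply: le_v.
  + by move=> i w; apply: rewrites_context (le_v i isT).
  by exists (Pred p cs).
- rewrite geq_max => /andP[av bv].
  case=> [[? [/(rewrites_context av)[c [-> ->]] ->]]
        | [? [/(rewrites_context bv)[c [-> ->]] ->]]].
  + by exists (Equal c b); rewrite /= !(tsubst_fresh _ bv).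
  + by exists (Equal a c); rewrite /= !(tsubst_fresh _ av).
- by move=> Av [? [/(IH _ Av)[C [-> ->]] ->]]; exists (Neg C).
- rewrite geq_max => /andP[Av Bv].
  case=> [[? [/(IHA _ Av)[C [-> ->]] ->]] | [? [/(IHB _ Bv)[C [-> ->]] ->]]].
  + by exists (And C B); rewrite /= !(subst_fresh _ Bv).
  + by exists (And A C); rewrite /= !(subst_fresh _ Av).
- rewrite geq_max => /andP[Av Bv].
  case=> [[? [/(IHA _ Av)[C [-> ->]] ->]] | [? [/(IHB _ Bv)[C [-> ->]] ->]]].
  + by exists (Or C B); rewrite /= !(subst_fresh _ Bv).
  + by exists (Or A C); rewrite /= !(subst_fresh _ Av).
- rewrite geq_max => /andP[Av Bv].
  case=> [[? [/(IHA _ Av)[C [-> ->]] ->]] | [? [/(IHB _ Bv)[C [-> ->]] ->]]].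
  + by exists (Imp C B); rewrite /= !(subst_fresh _ Bv).
  + by exists (Imp A C); rewrite /= !(subst_fresh _ Av).
- by move=> Av [? [/(IH _ Av)[C [-> ->]] ->]]; exists (All x C).
- by move=> Av [? [/(IH _ Av)[C [-> ->]] ->]]; exists (Ex x C).
Qed.

(** The link with the equality rules: a fresh variable marks the rewritten
occurrence. *)
Lemma frewrites_subst l r (F G : formula L) : frewrites l r F G ->
  exists v C, [/\ ~~ occurs v l, ~~ occurs v r, F = subst v l C & G = subst v r C].
Proof.
pose v := maxn (fvar_bound F) (maxn (var_bound l) (var_bound r)).
move=> /(@frewrites_context _ _ _ v)[|C [FC GC]]; first by rewrite leq_maxl.
exists v, C; split=> //; apply: occurs_bound; rewrite /v.
  by rewrite maxnCA leq_maxl.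
by rewrite maxnA leq_maxr.
Qed.
End Rewriting.

(** * Saturation of the antecedent *)

Lemma In_cat (T : Type) (x : T) (s1 s2 : seq T) :
  List.In x (s1 ++ s2) <-> List.In x s1 \/ List.In x s2.
Proof. exact: in_app_iff. Qed.

Section Derivability.
Context {L : signature}.
Context (prec : term L -> term L -> Prop).
Implicit Types (Gam Del Lam : seq (formula L)) (F G H e : formula L) (l r : term L).

Definition semishort Gam H : Prop :=
  exists d : derivation Gam H, cut_free d /\ semishortening prec d.

Lemma semishort_id F : semishort [:: F] F.
Proof. by exists (Axiom_id F). Qed.

Lemma semishort_refl (t : term L) : semishort [::] (Equal t t).
Proof. by exists (Axiom_refl t). Qed.

Lemma semishort_perm Gam Del H :
  Permutation Gam Del -> semishort Gam H -> semishort Del H.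
Proof.
move=> perm_GD; suff : forall Lam, semishort (Lam ++ Gam) H -> semishort (Lam ++ Del) H.
  exact (fun h => h [::]).
elim: perm_GD => {Gam Del} [// | F Gam Del _ IH | F G Gam
  | Gam1 Gam2 Gam3 _ IH1 _ IH2] Lam.
- by rewrite -!cat_rcons; apply: IH.
- by case=> d ok; exists (Exchange d).
- by move=> /IH1/IH2.
Qed.

Lemma semishort_weaken Gam Del H : semishort Gam H -> semishort (Gam ++ Del) H.
Proof.
elim: Del Gam => [|F Del IH] Gam; first by rewrite cats0.
by case=> d ok; rewrite -cat_rcons -cats1; apply: IH; exists (Weakening F d).
Qed.

(** With all structural rules at hand, antecedents behave as finite sets. *)
Lemma semishort_incl Gam Del H : incl Gam Del -> semishort Gam H -> semishort Del H.
Proof.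
move=> sub der; have {der} : semishort (Gam ++ Del) H by apply: semishort_weaken.
elim: Gam sub => [// | F Gam IH] sub der; apply: IH.
  by move=> G inG; apply: sub; right.
have [Del1 [Del2 eqD]] := in_split F Del (sub F (or_introl erefl)).
have [d ok] : semishort ((Gam ++ Del1 ++ Del2) ++ [:: F; F]) H.
  apply: semishort_perm der; rewrite eqD; apply: Permutation_sym.
  apply: Permutation_trans (Permutation_app_comm _ [:: F; F]) _.
  by rewrite /=; apply: perm_skip; rewrite /= !catA; apply: Permutation_middle.
have : semishort ((Gam ++ Del1 ++ Del2) ++ [:: F]) H by exists (Contraction d).
apply: semishort_perm; apply: Permutation_trans (Permutation_app_comm _ [:: F]) _.
by rewrite eqD /= !catA; apply: Permutation_middle.
Qed.

(** The direction of the equation e that semishortening inferences can use.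
Bottom-up, =_2 replaces the left side of the equation by the right one and =_1
the right side by the left one. *)
Definition oriented e l r : Prop :=
  (e = Equal l r /\ ~ prec l r) \/ (e = Equal r l /\ prec r l).

Context (prec_asym : forall r s : term L, prec r s -> ~ prec s r).

Lemma semishort_rewrite_r Gam e l r H H' : oriented e l r -> List.In e Gam ->
  frewrites l r H H' -> semishort Gam H' -> semishort Gam H.
Proof.
move=> ori in_e /frewrites_subst[v [C [nl nr -> ->]]] [d [cf [nonlen short]]].
apply: (@semishort_incl (Gam ++ [:: e])).
  by move=> F /In_cat[// | [<- //|//]].
case: ori => [[-> nprec] | [-> rl]].
  by exists (Eq2 nr nl d).
by exists (Eq1 nr nl d); do !split=> //; apply: prec_asym.
Qed.

(** The contexts keep both e and F, whose copies are contracted; this covers the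
case where F is e itself, so that an equation may rewrite itself. *)
Lemma semishort_rewrite_l Gam e l r F F' H : oriented e l r -> List.In e Gam ->
  List.In F Gam -> frewrites l r F F' -> semishort (F' :: Gam) H -> semishort Gam H.
Proof.
move=> ori in_e in_F /frewrites_subst[v [C [nl nr eqF ->]]] der.
have [d [cf [nonlen short]]] : semishort (Gam ++ [:: subst v r C]) H.
  exact: semishort_perm (Permutation_cons_append _ _) der.
apply: (@semishort_incl (Gam ++ [:: F; e])).
  by move=> G /In_cat[// | [<- // | [<- // | //]]].
rewrite eqF; case: ori => [[-> nprec] | [-> rl]].
  by exists (Eq2l nr nl d).
by exists (Eq1l nr nl d); do !split=> //; apply: prec_asym.
Qed.

(** The equations used for rewriting are themselves members of the saturation,
so the directions in which they apply are recomputed after each rewriting. *)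
Inductive saturated Gam : formula L -> Prop :=
| saturated_in F : List.In F Gam -> saturated Gam F
| saturated_rewrite e l r F G : oriented e l r -> saturated Gam e ->
    saturated Gam F -> frewrites l r F G -> saturated Gam G.

(** Cut admissibility in the form needed: members of the saturation can be
removed by left inferences, since each of them arises by rewriting from others
that can be removed as well. *)
Lemma semishort_saturated Gam F H :
  saturated Gam F -> semishort (F :: Gam) H -> semishort Gam H.
Proof.
suff gen : saturated Gam F -> forall Del, incl Gam Del ->
    semishort (F :: Del) H -> semishort Del H.
  by move=> satF; apply: gen satF _ _; apply: incl_refl.
elim=> {F} [F in_F | e l r F G ori _ IHe _ IHF FG] Del sub der.
  by apply: semishort_incl der => G [<- | //]; apply: sub.
apply: (IHe _ sub); apply: IHF; first exact: incl_tl.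
apply: (semishort_rewrite_l ori _ _ FG); [by right; left | by left |].
by apply: semishort_incl der => K [<- | inK]; [left | do 3!right].
Qed.

Definition rule Gam l r : Prop :=
  exists e, oriented e l r /\ saturated Gam e.

Lemma rule_or Gam l r : saturated Gam (Equal l r) -> rule Gam l r \/ rule Gam r l.
Proof.
move=> sat; case: (classic (prec l r)) => p; [right | left].
  by exists (Equal l r); split=> //; right.
by exists (Equal l r); split=> //; left.
Qed.

(** Rewriting the left-hand side of an oriented equation rewrites the equation,
and the result is in the saturation, where it has some direction. *)
Lemma rule_interreduced Gam : interreduced (rule Gam).
Proof.
move=> l r l' r' t [e [ori sat_e]] [e' [ori' sat_e']] lt.
case: ori => [[eq_e _] | [eq_e _]]; subst e.
  apply: rule_or; apply: saturated_rewrite ori' sat_e' sat_e _.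
  by left; exists t.
apply/or_comm/rule_or; apply: saturated_rewrite ori' sat_e' sat_e _.
by right; exists t.
Qed.

Lemma saturated_Rstar Gam F G :
  Rstar _ (@freduces L (rule Gam) [::]) F G -> saturated Gam F -> saturated Gam G.
Proof.
elim=> // F1 F2 F3 step _ IH satF; apply: IH.
case: step => [<- // | [l [r [[e [ori sat_e]] FG]]]].
exact: saturated_rewrite ori sat_e satF FG.
Qed.

Lemma semishort_Rstar Gam F G :
  Rstar _ (@freduces L (rule Gam) [::]) F G -> semishort Gam G -> semishort Gam F.
Proof.
elim=> // F1 F2 F3 step _ IH /IH der.
case: step => [-> // | [l [r [[e [ori sat_e]] FG]]]].
apply: semishort_saturated sat_e _.
apply: semishort_rewrite_r ori _ FG _; first by left.
exact: semishort_incl (incl_tl _ (incl_refl _)) der.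
Qed.

(** * Entailment and the calculus *)

(** A cut-free description of derivability that does not mention derivations. *)
Definition entailed Gam H : Prop :=
  (exists2 F, List.In F Gam & fjoin (rule Gam) F H) \/
  exists t, fjoin (rule Gam) (Equal t t) H.

Lemma fjoin_trans Gam F G H : fjoin (rule Gam) F G -> fjoin (rule Gam) G H ->
  fjoin (rule Gam) F H.
Proof. exact: coherent_trans (freduces_confluent (@rule_interreduced Gam)) F G H. Qed.

Lemma tjoin_trans Gam (r s t : term L) : tjoin (rule Gam) r s ->
  tjoin (rule Gam) s t -> tjoin (rule Gam) r t.
Proof. exact: coherent_trans (reduces_confluent (@rule_interreduced Gam)) r s t. Qed.

Lemma tjoin_Equal Gam (a b : term L) :
  List.In (Equal a b) Gam -> tjoin (rule Gam) a b.
Proof.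
have step l r : rule Gam l r -> tjoin (rule Gam) l r.
  move=> lr; apply/coherent_step/(reduces_step lr).
  by have := rewrites_root l r [::]; rewrite !term_in_nil.
by move=> /saturated_in/rule_or[/step // | /step]; apply: coherent_symmetric.
Qed.

(** Common reducts are reached by left inferences from the antecedent and by
right inferences from the succedent.  When the common reduct of H and t = t is
an equation a = b, its sides are joinable through t, so rewriting goes on
until both sides coincide. *)
Lemma entailed_semishort Gam H : entailed Gam H -> semishort Gam H.
Proof.
case=> [[F in_F [G [FG HG]]] | [t [G [tG HG]]]]; apply: semishort_Rstar HG _.
  apply: (semishort_saturated (saturated_Rstar FG (saturated_in in_F))).
  by apply: semishort_incl (semishort_id G) => K [<- | //]; left.
have [a [b [-> ta tb]]] :=
  fjoin_Equal (@rule_interreduced Gam) (Rstar_imp_coherent _ _ _ _ tG).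
have [c [ac bc]] := tjoin_trans (coherent_symmetric _ _ _ _ ta) tb.
apply: (@semishort_Rstar _ _ (Equal c b)).
  by apply: (Rstar_map (f := Equal^~ b)) ac => ? ?; apply: freduces_Equal_l.
apply: (@semishort_Rstar _ _ (Equal c c)).
  by apply: (Rstar_map (f := Equal c)) bc => ? ?; apply: freduces_Equal_r.
exact: semishort_incl (incl_nil_l _) (semishort_refl c).
Qed.

Lemma entailed_in Gam F : List.In F Gam -> entailed Gam F.
Proof. by move=> in_F; left; exists F => //; apply: coherent_refl. Qed.

Lemma entailed_fjoin Gam F G : entailed Gam F -> fjoin (rule Gam) F G -> entailed Gam G.
Proof.
by case=> [[K in_K KF] | [t tF]] FG; [left; exists K | right; exists t];
  rewrite //; apply: fjoin_trans FG.
Qed.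

Lemma entailed_Equal Gam (a b : term L) :
  entailed Gam (Equal a b) -> tjoin (rule Gam) a b.
Proof.
have key c d : fjoin (rule Gam) (Equal c d) (Equal a b) ->
    tjoin (rule Gam) c d -> tjoin (rule Gam) a b.
  move=> /(fjoin_Equal (@rule_interreduced Gam))[a' [b' [[-> ->] ca db]]] cd.
  exact: tjoin_trans (coherent_symmetric _ _ _ _ ca) (tjoin_trans cd db).
case=> [[F in_F Fab] | [t tab]]; last exact: key tab (coherent_refl _ _).
have [c [d [eqF _ _]]] :=
  fjoin_Equal (@rule_interreduced Gam) (coherent_symmetric _ _ _ _ Fab).
by move: in_F Fab; rewrite eqF => /tjoin_Equal cd /key; apply.
Qed.

Lemma frewrites_fjoin Gam l r F G : tjoin (rule Gam) l r ->
  frewrites l r F G -> fjoin (rule Gam) F G.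
Proof.
move=> lr /frewrites_subst[v [C [_ _ -> ->]]].
exact: subst_join (@rule_interreduced Gam) lr.
Qed.

Lemma entailed_saturated Gam Del G : (forall F, List.In F Del -> entailed Gam F) ->
  saturated Del G -> entailed Gam G.
Proof.
move=> ent; elim=> {G} [F /ent // | e l r F G ori _ ent_e _ ent_F FG].
apply: entailed_fjoin ent_F (frewrites_fjoin _ FG).
case: ori ent_e => [[-> _] | [-> _]] /entailed_Equal //.
exact: coherent_symmetric.
Qed.

(** Equations entailed by Gam are joinable over Gam, so every rewriting step
over the saturation of Del is a joinability over Gam. *)
Lemma entailed_cut Gam Del H : (forall F, List.In F Del -> entailed Gam F) ->
  entailed Del H -> entailed Gam H.
Proof.
move=> ent.
have star F G : Rstar _ (@freduces L (rule Del) [::]) F G -> fjoin (rule Gam) F G.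
  elim=> [K | F1 F2 F3 step _]; first exact: coherent_refl.
  apply: fjoin_trans; case: step => [-> | [l [r [[e [ori sat_e]] FG]]]].
    exact: coherent_refl.
  apply: frewrites_fjoin _ FG; move: (entailed_saturated ent sat_e).
  case: ori => [[-> _] | [-> _]] /entailed_Equal //.
  exact: coherent_symmetric.
have join F G : fjoin (rule Del) F G -> fjoin (rule Gam) F G.
  case=> K [/star FK GK]; apply: fjoin_trans FK _.
  by apply/coherent_symmetric/star.
case=> [[F inF /join FH] | [t /join tH]]; last by right; exists t.
exact: entailed_fjoin (ent F inF) FH.
Qed.

Lemma entailed_incl Gam Del H : incl Gam Del -> entailed Gam H -> entailed Del H.
Proof. by move=> sub; apply: entailed_cut => F /sub; apply: entailed_in. Qed.

(** Left equality rules are cuts: the premiss member is joinable with the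
member that replaces it, by the equation that the conclusion adds. *)
Lemma derivation_entailed Gam H : derivation Gam H -> entailed Gam H.
Proof.
have last_eq K1 (a b : term L) : tjoin (rule (K1 ++ [:: Equal a b])) a b.
  by apply/tjoin_Equal/In_cat; right; left.
elim=> {Gam H} [F | t | Gam F H _ | Gam Lam F G H _ | Gam F H _
  | Gam Lam F H _ IHF _ IHH | Gam F v r s _ _ _ IH | Gam F v r s _ _ _ IH
  | Gam F H v r s _ _ _ | Gam F H v r s _ _ _].
- by apply: entailed_in; left.
- by right; exists t; apply: coherent_refl.
- exact: entailed_incl (incl_appl _ (incl_refl _)).
- apply: entailed_incl => K; rewrite !In_cat /=; tauto.
- apply: entailed_incl => K; rewrite !In_cat /=; tauto.
- apply: entailed_cut IHH => K /In_cat[inK | [<- | //]].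
    by apply: entailed_in; apply/In_cat; right.
  exact: entailed_incl (incl_appl _ (incl_refl _)) IHF.
- apply: entailed_fjoin (entailed_incl (incl_appl _ (incl_refl _)) IH) _.
  exact: subst_join (@rule_interreduced _) (last_eq _ _ _).
- apply: entailed_fjoin (entailed_incl (incl_appl _ (incl_refl _)) IH) _.
  apply: subst_join (@rule_interreduced _) _.
  exact: coherent_symmetric (last_eq _ _ _).
- apply: entailed_cut => K /In_cat[inK | [<- | //]].
    by apply: entailed_in; apply/In_cat; left.
  rewrite -(cat1s _ [:: _]) catA.
  apply: entailed_fjoin (entailed_in (F := subst v s F) _) _.
    by rewrite !In_cat /=; tauto.
  apply: subst_join (@rule_interreduced _) _.
  exact: coherent_symmetric (last_eq _ _ _).
- apply: entailed_cut => K /In_cat[inK | [<- | //]].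
    by apply: entailed_in; apply/In_cat; left.
  rewrite -(cat1s _ [:: _]) catA.
  apply: entailed_fjoin (entailed_in (F := subst v s F) _) _.
    by rewrite !In_cat /=; tauto.
  exact: subst_join (@rule_interreduced _) (last_eq _ _ _).
Qed.
End Derivability.

Theorem theorem1p8 (L : signature) (prec : term L -> term L -> Prop)
    (prec_asym : forall r s : term L, prec r s -> ~ prec s r)
    (Gam : seq (formula L)) (H : formula L) (d : derivation Gam H) :
  exists d' : derivation Gam H, cut_free d' /\ semishortening prec d'.
Proof. exact: (entailed_semishort prec_asym (derivation_entailed prec d)). Qed.
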